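(* There exists a constant $c > 0$ such that for every Sidon set $A \subset \mathbb{Z}$ one has $|\Sigma^* A| \geq c |A|^3$.
   Context: A set $A \subset \mathbb{Z}$ is a Sidon set if all sums $a_1 + a_2$ with $a_1, a_2 \in A$, $a_1 \le a_2$, are distinct, i.e. $|A+A| = \binom{|A|+1}{2}$. For $A \subseteq \mathbb{Z}$, $\Sigma^* A = \{\sum_{b \in B} b : B \subseteq A\}$ denotes the restricted sumset (sums over all subsets of $A$, including the empty sum $0$). *)

(* Defs.v *)
From HB Require Import structures.
From mathcomp Require Import all_boot all_order all_algebra finmap reals.

Set Implicit Arguments.
Unset Strict Implicit.
Unset Printing Implicit Defensive.

Import Order.TTheory GRing.Theory Num.Theory.

Local Open Scope fset_scope.
Local Open Scope ring_scope.

Definition sidon (A : {fset int}) : Prop :=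
  forall a1 a2 b1 b2 : int,
    a1 \in A -> a2 \in A -> b1 \in A -> b2 \in A ->
    a1 <= a2 -> b1 <= b2 ->
    a1 + a2 = b1 + b2 -> a1 = b1 /\ a2 = b2.

Definition subset_sums (A : {fset int}) : {fset int} :=
  [fset \sum_(b <- B) b | B : {fset int} in fpowerset A].

(* Main.v *)
Require Import Defs.
From HB Require Import structures.
From mathcomp Require Import all_boot all_order all_algebra finmap reals.
From mathcomp Require Import zify.

Set Implicit Arguments.
Unset Strict Implicit.
Unset Printing Implicit Defensive.

Import Order.TTheory GRing.Theory Num.Theory.

(** Sort [A] and cut it, up to at most three leftover elements, into four
consecutive blocks [L < B < C < U] of size [m].  Replacing the elements of [L]
one at a time by those of [U] gives [m] sums [G 0 < G 1 < ...] whose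
consecutive gaps exceed the diameter of [B ∪ C].  By the Sidon property the [m ^ 2]
sums [b + c] with [b] in [B] and [c] in [C] are distinct, and since [B] lies
below [C] they fit in a window no longer than that diameter.  Hence the
[m ^ 3] subset sums [G i + b + c] are distinct. *)

Local Open Scope fset_scope.
Local Open Scope ring_scope.

Lemma sum_seq_subset_sums (A : {fset int}) (q : seq int) :
  uniq q -> {subset q <= A} -> \sum_(x <- q) x \in subset_sums A.
Proof.
move=> uq qA; apply/imfsetP; exists [fset x in q] => /=.
  by rewrite fpowersetE; apply/fsubsetP => x; rewrite inE; apply: qA.
apply: perm_big; apply: uniq_perm => // [|x]; first exact: fset_uniq.
by rewrite inE.
Qed.

(** Index of the term in slot [t] after [i] replacements. The slots stay [t < m] for every [i], so
    two stages can be compared term by term. *)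
Definition exchange (m i t : nat) : nat := if (t < i)%N then (3 * m + t)%N else t.

Section SortedBlocks.

Variables (a : nat -> int) (m : nat).
Hypothesis a_lt : forall p q, (p < q < 4 * m)%N -> a p < a q.

Lemma blocks_le p q : (p <= q < 4 * m)%N -> a p <= a q.
Proof.
case/andP; rewrite leq_eqVlt => /predU1P[-> //|pq] qm.
by apply: ltW; apply: a_lt; rewrite pq.
Qed.

(** Slot [i] still holds [a i] at stage [i] but [a (3 * m + i)] at stage [i']; no other slot
    decreases. *)
Lemma exchange_gap i i' : (i < i' < m)%N ->
  \sum_(t < m) a (exchange m i t) + (a (3 * m + i)%N - a i) <=
  \sum_(t < m) a (exchange m i' t).
Proof.
case/andP=> ii' i'm; have im : (i < m)%N by apply: ltn_trans i'm.
rewrite (bigD1 (Ordinal im)) //= [leRHS](bigD1 (Ordinal im)) //=.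
rewrite {1 3}/exchange ltnn ii' addrAC addrCA subrr addr0 lerD2l.
apply: ler_sum => t _; apply: blocks_le; rewrite /exchange.
by have := ltn_ord t; do 2?case: ifP; lia.
Qed.

Definition block_sum (x : 'I_m * 'I_m * 'I_m) : int :=
  a (m + x.1.2) + (a (2 * m + x.2) + \sum_(t < m) a (exchange m x.1.1 t)).

Lemma block_sum_lt (i j k i' j' k' : 'I_m) :
  (i < i')%N -> block_sum (i, j, k) < block_sum (i', j', k').
Proof.
move=> ii'; have := ltn_ord i' => i'm.
have gap := @exchange_gap i i'; rewrite ii' i'm in gap; move/(_ isT): gap.
have lj := ltn_ord j; have lk := ltn_ord k.
have lj' := ltn_ord j'; have lk' := ltn_ord k'.
(* The comparison is crosswise: [B] against [C], [C] against [U], [L] against [B]. Added to [gap],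
   these three inequalities give the claim for all [j], [k], [j'], [k']. *)
have h1 : a (m + j)%N < a (2 * m + k')%N by apply: a_lt; lia.
have h2 : a (2 * m + k)%N < a (3 * m + i)%N by apply: a_lt; lia.
have h3 : a i < a (m + j')%N by apply: a_lt; lia.
by rewrite /block_sum /=; lia.
Qed.

End SortedBlocks.

Lemma sidon_subset_sums_card (A : {fset int}) (m : nat) :
  sidon A -> (4 * m <= #|` A|)%N -> (m ^ 3 <= #|` subset_sums A|)%N.
Proof.
move=> sA mA.
set s := sort <=%R A; pose a := nth 0 s.
have ss : size s = #|` A| by rewrite size_sort.
have us : uniq s by rewrite sort_uniq fset_uniq.
have aA p : (p < 4 * m)%N -> a p \in A.
  by move=> pm; rewrite -(mem_sort <=%R) mem_nth // -/s ss; lia.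
have a_lt p q : (p < q < 4 * m)%N -> a p < a q.
  case/andP=> pq qm; have st : sorted <%R s.
    by rewrite lt_sorted_uniq_le us sort_le_sorted.
  by apply: (sorted_ltn_nth lt_trans) => //; rewrite inE ss; lia.
have a_inj p q : (p < 4 * m)%N -> (q < 4 * m)%N -> a p = a q -> p = q.
  by move=> pm qm /eqP; rewrite nth_uniq ?ss; [move/eqP| lia | lia |].
have inj : injective (block_sum a (m := m)).
  move=> [[i j] k] [[i' j'] k'] e.
  have /val_inj eii' : i = i' :> nat.
    by case: (ltngtP i i') => // /(block_sum_lt a_lt) lt;
      [have := lt j k j' k' | have := lt j' k' j k]; rewrite e ltxx.
  move: e; rewrite -eii' /block_sum /= !addrA => /addIr e.
  have lj := ltn_ord j; have lk := ltn_ord k.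
  have lj' := ltn_ord j'; have lk' := ltn_ord k'.
  (* Each pair is already in increasing order, as [sidon] requires, because the second block lies
     below the third. *)
  have [] : a (m + j)%N = a (m + j')%N /\ a (2 * m + k)%N = a (2 * m + k')%N.
    by apply: sA e; try apply: aA; try apply/ltW/a_lt; lia.
  move/a_inj => ej /a_inj ek.
  have /val_inj-> : j = j' :> nat by lia.
  by have /val_inj-> : k = k' :> nat by lia.
have -> : (m ^ 3)%N = size (codom (block_sum a (m := m))).
  by rewrite size_codom !card_prod card_ord -mulnA; lia.
apply: uniq_leq_size; first exact/injectiveP.
move=> _ /codomP[[[i j] k] ->]; rewrite /block_sum /=.
have li := ltn_ord i; have lj := ltn_ord j; have lk := ltn_ord k.
pose q := (m + j)%N :: (2 * m + k)%N :: [seq exchange m i t | t <- iota 0 m].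
(* Exchanged indices stay in the outer two blocks, so they never meet [m + j] or [2 * m + k]. *)
have exm t : (t < m)%N -> (exchange m i t < m)%N || (3 * m <= exchange m i t < 4 * m)%N.
  by rewrite /exchange; case: ifP; lia.
have qm p : p \in q -> (p < 4 * m)%N.
  rewrite !inE => /or3P[/eqP->|/eqP->|/mapP[t]]; try lia.
  by rewrite mem_iota => /exm ? ->; lia.
have uq : uniq q.
  rewrite /= inE negb_or -!andbA; apply/and4P; split; first lia.
  - by apply/mapP => -[t]; rewrite mem_iota => /exm ? ?; lia.
  - by apply/mapP => -[t]; rewrite mem_iota => /exm ? ?; lia.
  rewrite map_inj_in_uniq ?iota_uniq // => t t'; rewrite !mem_iota /exchange.
  by do 2?case: ifP; lia.
have -> : a (m + j)%N + (a (2 * m + k)%N + \sum_(t < m) a (exchange m i t)) =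
          \sum_(x <- map a q) x.
  by rewrite big_map 2!big_cons big_map -(big_mkord xpredT (fun t => a (exchange m i t)))
             /index_iota subn0.
apply: sum_seq_subset_sums.
  by rewrite map_inj_in_uniq // => p p' /qm ? /qm ?; apply: a_inj.
by move=> _ /mapP[p /qm pm ->]; apply: aA.
Qed.

Theorem theorem4 (R : realType) :
  exists c : R, 0 < c /\
    forall A : {fset int}, sidon A ->
      c * #|` A|%:R ^+ 3 <= #|` subset_sums A|%:R.
Proof.
(* Here [343 = 7 ^ 3]: if [m = n %/ 4] is positive, then [n <= 4 * m + 3 <= 7 * m]. *)
exists (343%:R^-1); split; first by rewrite invr_gt0 ltr0n.
move=> A sA; rewrite mulrC ler_pdivrMr ?ltr0n // -natrX -natrM ler_nat.
set n := #|` A|; pose m := (n %/ 4)%N.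
have [m0|m_gt0] := posnP m.
  (* With no full block, the empty sum alone suffices, since [3 ^ 3 <= 343]. *)
  have n3 : (n <= 3)%N by lia.
  have S_gt0 : (0 < #|` subset_sums A|)%N.
    rewrite cardfs_gt0; apply/fset0Pn; exists (\sum_(x <- [::]) x).
    exact: sum_seq_subset_sums.
  apply: leq_trans (_ : 3 ^ 3 <= _)%N; first by rewrite leq_exp2r.
  by lia.
have le_mS : (m ^ 3 <= #|` subset_sums A|)%N.
  by apply: sidon_subset_sums_card => //; lia.
apply: leq_trans (_ : (7 * m) ^ 3 <= _)%N; first by rewrite leq_exp2r //; lia.
by rewrite expnMn mulnC leq_mul2r le_mS orbT.
Qed.
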